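(* For every real number $t\in(1,\infty)$ there is a shift space with entropy $t$; that is, there exist a finite alphabet $\mathscr{A}$ and a shift space $Y\subset\mathscr{A}^{\mathbb{N}}$ such that $h(Y)=t$.
   Context: $\mathbb{N}$ denotes the set of positive integers and $\log$ is the logarithm to base $2$. Let $\mathscr{A}$ be a finite set (alphabet). A block over $\mathscr{A}$ is a finite (possibly empty) sequence of symbols from $\mathscr{A}$; $\mathscr{A}^*$ is the set of all blocks; an $n$-block is a block of length $n$. A block $w$ occurs in $x=(x_i)_{i=1}^\infty\in\mathscr{A}^{\mathbb{N}}$ if $w=x_ix_{i+1}\ldots x_j$ for some integers $1\le i\le j$; the empty block occurs in every sequence. A shift space over $\mathscr{A}$ is a set $X\subset\mathscr{A}^{\mathbb{N}}$ for which there is a collection $\mathscr{F}\subset\mathscr{A}^*$ such that $X$ is the set of all sequences in $\mathscr{A}^{\mathbb{N}}$ in which no block from $\mathscr{F}$ occurs. The language $\mathscr{B}(X)$ of $X$ is the set of all blocks occurring in some sequence of $X$, and $\mathscr{B}_n(X)$ is the set of $n$-blocks in $\mathscr{B}(X)$. Entropy is defined for nonempty shift spaces: the entropy of a nonempty shift space $X$ is $h(X)=\lim_{n\to\infty}\frac1n\log|\mathscr{B}_n(X)|$ (the limit exists by subadditivity and equals the infimum over $n\ge 1$). In particular, ''a shift space with entropy $t$'' is understood to be nonempty. *)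

(* Defs.v *)
From HB Require Import structures.
From mathcomp Require Import all_boot all_order all_algebra.
From mathcomp Require Import all_classical all_reals all_analysis.

Set Implicit Arguments.
Unset Strict Implicit.
Unset Printing Implicit Defensive.

Import Order.TTheory GRing.Theory Num.Theory.
Import numFieldNormedType.Exports.

Local Open Scope classical_set_scope.
Local Open Scope ring_scope.

(* One-sided sequences (x_1, x_2, ...) over A are functions x : nat -> A, with
   x_i represented by x i.-1. *)

(* The empty block occurs in every sequence. *)
Definition occurs (A : Type) (w : seq A) (x : nat -> A) : Prop :=
  exists i : nat, w = mkseq (fun k => x (i + k)%N) (size w).

Definition shift_space (A : finType) (X : set (nat -> A)) : Prop :=
  exists F : set (seq A), X = [set x | forall w, F w -> ~ occurs w x].

Definition language (A : finType) (X : set (nat -> A)) : set (seq A) :=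
  [set w | exists2 x, X x & occurs w x].

Definition nblocks (A : finType) (X : set (nat -> A)) (n : nat)
    : {set n.-tuple A} :=
  [set w : n.-tuple A | `[< language X w >]]%SET.

Definition log2 (R : realType) (x : R) : R := ln x / ln 2.

(* The term of index 0 is a junk value, irrelevant for the limit. *)
Definition entropy_seq (R : realType) (A : finType) (X : set (nat -> A))
    (n : nat) : R :=
  n%:R^-1 * log2 (#|nblocks X n|%:R).

(* "h(X) = h": X is nonempty, and the limit defining its entropy exists and
   equals h. Limits in R are unique, so there is at most one such h. *)
Definition has_entropy (R : realType) (A : finType) (X : set (nat -> A))
    (h : R) : Prop :=
  X !=set0 /\ entropy_seq R X @ \oo --> h.

(* Main.v *)
(* Let k > t and alpha = t / k, and let s be a 0-1 word of slope alpha, i.e.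
   s_j = floor(theta + (j+1) alpha) - floor(theta + j alpha) for some theta.
   Such words of length n number only polynomially many, and each has
   n alpha + O(1) ones. Filling every position of a one with an arbitrary symbol among
   2^k symbols, and that of a zero with a fixed blank, gives 2^(n alpha k + O(log n))
   blocks of length n, hence entropy alpha k = t. *)
Require Import Defs.
From mathcomp Require Import all_boot all_order all_algebra.
From mathcomp Require Import all_classical all_reals all_analysis.
From mathcomp Require Import lra zify.

Set Implicit Arguments.
Unset Strict Implicit.
Unset Printing Implicit Defensive.

Import Order.TTheory GRing.Theory Num.Theory.
Import numFieldNormedType.Exports.

Local Open Scope classical_set_scope.
Local Open Scope ring_scope.

(** * Fillings of a fixed 0-1 pattern *)

Lemma card_isSome_fiber (T : finType) n (p : n.-tuple bool) :
  #|[set w : n.-tuple (option T) | map_tuple isSome w == p]%SET|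
  = (#|T| ^ count id p)%N.
Proof.
elim: n p => [|n IHn] p.
  rewrite tuple0 expn0 -[RHS](card_tuple 0 (option T)); apply: eq_card => w.
  by rewrite !inE !tuple0 eqxx.
case/tupleP: p => b p /=; rewrite expnD -IHn.
pose A := [set a : option T | isSome a == b]%SET.
have -> : (#|T| ^ b = #|A|)%N.
  case: b @A => A.
    have injS : injective (@Some T) by move=> ? ? [].
    rewrite expn1 -(card_imset predT injS); apply: eq_card => -[a|].
      by rewrite inE eqxx; apply/imsetP; exists a.
    by rewrite inE; apply/negP => /imsetP[].
  by rewrite expn0 -(cards1 (@None T)); apply: eq_card => -[a|]; rewrite !inE.
(* Head and tail are chosen independently: consing maps [A] times the fiber of [p] bijectively onto
   the fiber of [b :: p]. *)
rewrite -cardsX -(card_imset _ 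
    (f := fun u : option T * n.-tuple (option T) => [tuple of u.1 :: u.2])).
  apply: eq_card => w; case/tupleP: w => a w; rewrite inE.
  apply/eqP/imsetP => [/(congr1 val)[eb ep]|[[a' w']]].
    by exists (a, w) => //; rewrite !inE eb eqxx /=; apply/eqP/val_inj.
  rewrite !inE /= => /andP[/eqP eb /eqP ep] /(congr1 val)[-> ew].
  by apply: val_inj; rewrite /= eb -ep /= ew.
move=> [a w] [a' w'] /(congr1 val)[-> ew]; congr (_, _); exact: val_inj.
Qed.

(** * Mechanical words: prefix counts and number of words *)

Section Mechanical.
Variables (R : realType) (alpha : R).
Hypotheses (alpha_ge0 : 0 <= alpha) (alpha_le1 : alpha <= 1).
Implicit Types (theta : R) (n : nat).

(* For 0 <= alpha <= 1 consecutive floors differ by 0 or 1, so this boolean is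
   their difference. *)
Definition mech theta n : bool :=
  Num.floor (theta + n.+1%:R * alpha) != Num.floor (theta + n%:R * alpha).

Definition mechanical (p : seq bool) : Prop :=
  exists theta, p = mkseq (mech theta) (size p).

Lemma floorD_step (x y : R) : 0 <= y <= 1 ->
  Num.floor (x + y) - Num.floor x = (Num.floor (x + y) != Num.floor x)%:Z.
Proof.
move=> /andP[y0 y1].
have l : Num.floor x <= Num.floor (x + y) by apply: le_floor; lra.
have : Num.floor (x + y) < Num.floor x + 2.
  have /andP[_ h] := floor_itv x; rewrite floor_lt_int.
  by move: h; rewrite !intrD; lra.
by case: eqP => /=; lia.
Qed.

Lemma count_mkseqS (f : pred nat) n :
  count id (mkseq f n.+1) = (count id (mkseq f n) + f n)%N.
Proof. by rewrite mkseqS -cats1 count_cat /= addn0. Qed.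

Lemma count_mech theta n :
  (count id (mkseq (mech theta) n))%:Z
  = Num.floor (theta + n%:R * alpha) - Num.floor theta.
Proof.
elim: n => [|n IHn]; first by rewrite mul0r addr0 subrr.
rewrite count_mkseqS PoszD IHn /mech.
have -> : theta + n.+1%:R * alpha = theta + n%:R * alpha + alpha.
  by rewrite -addn1 natrD; lra.
by rewrite -floorD_step ?alpha_ge0 //; lia.
Qed.

(** The integer [Num.floor theta] can be moved inside the other floor. In this form the count is
    visibly monotone in the fractional part of [theta]. *)
Lemma count_mech_frac theta n :
  (count id (mkseq (mech theta) n))%:Z
  = Num.floor (theta - (Num.floor theta)%:~R + n%:R * alpha).
Proof.
by rewrite count_mech addrAC -mulrNz [RHS]floorDrz ?intr_int // intrKfloor.
Qed.

Lemma frac_itv theta : 0 <= theta - (Num.floor theta)%:~R < 1.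
Proof. by have := floor_itv theta; rewrite intrD; lra. Qed.

(** The fractional part of [theta] lies in [0, 1), so the count lies between the floors of n alpha
    and n alpha + 1. *)
Lemma count_mech_itv theta n :
  (Num.truncn (n%:R * alpha) <= count id (mkseq (mech theta) n)
     <= (Num.truncn (n%:R * alpha)).+1)%N.
Proof.
have na : 0 <= n%:R * alpha by exact: mulr_ge0.
have /andP[t0 t1] := frac_itv theta.
have e : (Num.truncn (n%:R * alpha))%:Z = Num.floor (n%:R * alpha).
  by rewrite truncn_floor na gez0_abs // floor_ge0.
have := @le_floor R (n%:R * alpha) (theta - (Num.floor theta)%:~R + n%:R * alpha).
have := @le_floor R (theta - (Num.floor theta)%:~R + n%:R * alpha) (n%:R * alpha + 1%:~R).
rewrite -count_mech_frac floorDrz ?intr_int // intrKfloor -e.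
move=> /(_ ltac:(lra)) h1 /(_ ltac:(lra)) h2; lia.
Qed.

Lemma eq_mkseq_count (f g : pred nat) n :
  (forall j, (j <= n)%N -> count id (mkseq f j) = count id (mkseq g j)) ->
  mkseq f n = mkseq g n.
Proof.
move=> h; apply: (@eq_from_nth _ false); rewrite !size_mkseq // => j jn.
rewrite !nth_mkseq //; have := h _ jn; rewrite !count_mkseqS h ?(ltnW jn) //.
by move=> /addnI; case: (f j) (g j) => [] [].
Qed.

(* The prefix counts of a mechanical word are nondecreasing in the fractional
   part of its intercept, so the sum of these counts determines the word. *)
Lemma mech_inj theta theta' n :
  (\sum_(j < n.+1) count id (mkseq (mech theta) j)
   = \sum_(j < n.+1) count id (mkseq (mech theta') j))%N ->
  mkseq (mech theta) n = mkseq (mech theta') n.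
Proof.
wlog le_tt' : theta theta' / theta - (Num.floor theta)%:~R
                             <= theta' - (Num.floor theta')%:~R.
  move=> H; have [|/ltW] := leP (theta - (Num.floor theta)%:~R)
                             (theta' - (Num.floor theta')%:~R); first exact: H.
  by move=> /H h /esym/h.
have le_c j : (count id (mkseq (mech theta) j)
               <= count id (mkseq (mech theta') j))%N.
  by rewrite -lez_nat !count_mech_frac; apply: le_floor; rewrite lerD2r.
(* Termwise inequalities between two equal sums are all equalities. *)
move=> /eqP; rewrite (eq_leqif (leqif_sum (I := 'I_n.+1) (fun i _ => leqif_eq (le_c i)))).
move=> /forallP eq_c; apply: eq_mkseq_count => j; rewrite -ltnS => jn.
exact/eqP/(eq_c (Ordinal jn)).
Qed.

Definition mech_tuples n : {set n.-tuple bool} :=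
  [set p : n.-tuple bool | `[< mechanical p >]]%SET.

Lemma mech_tuplesP n (p : n.-tuple bool) :
  reflect (exists theta, p = mkseq (mech theta) n :> seq bool)
          (p \in mech_tuples n).
Proof.
by rewrite inE; apply: (iffP (asboolP _)) => -[theta e]; exists theta;
  move: e; rewrite size_tuple.
Qed.

(** By [mech_inj] the sum [wt] of the prefix counts is injective on mechanical words. It has n + 1
    terms, each at most n, so it takes values below (n + 1)^2. *)
Lemma card_mech_tuples n : (#|mech_tuples n| <= n.+1 ^ 2)%N.
Proof.
pose wt (p : n.-tuple bool) := (\sum_(j < n.+1) count id (take j p))%N.
have wt_lt p : (wt p < n.+1 ^ 2)%N.
  apply: (@leq_ltn_trans (\sum_(j < n.+1) n)); last first.
    by rewrite sum_nat_const card_ord -mulnn ltn_mul2l /=.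
  apply: leq_sum => j _; rewrite (leq_trans (count_size _ _)) //.
  by rewrite size_take_min size_tuple geq_minr.
rewrite -[leqRHS]card_ord -(card_in_imset (f := fun p => Ordinal (wt_lt p))).
  exact: max_card.
move=> p q /mech_tuplesP[t ep] /mech_tuplesP[t' eq] /(congr1 val)/= e.
apply: val_inj; rewrite /= ep eq; apply: mech_inj; move: e; rewrite /wt ep eq.
have take_mech (s : R) (j : 'I_n.+1) :
    take j (mkseq (mech s) n) = mkseq (mech s) j.
  by rewrite /mkseq -map_take take_iota (minn_idPl _) // -ltnS.
under eq_bigr do rewrite take_mech.
by under [RHS]eq_bigr do rewrite take_mech.
Qed.

(** Starting at position i amounts to replacing the intercept theta by theta + i alpha. *)
Lemma mechanical_sub (x : nat -> bool) theta i n :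
  (forall j, x j = mech theta j) -> mechanical (mkseq (fun k => x (i + k)%N) n).
Proof.
move=> ex; exists (theta + i%:R * alpha); rewrite size_mkseq.
apply: eq_mkseq => k; rewrite ex /mech -!addrA -!mulrDl -!natrD addnS.
by [].
Qed.

(** * The shift space and its block counts *)

Variable (T : finType).

Definition mech_shift : set (nat -> option T) :=
  [set x | forall w, ~ mechanical (map isSome w) -> ~ occurs w x].

Lemma shift_space_mech_shift : shift_space mech_shift.
Proof. by exists [set w | ~ mechanical (map isSome w)]. Qed.

(** For the converse, [w] is continued to the right along the mechanical sequence of the same
    intercept, with [a] at every one; all factors of that sequence are mechanical. *)
Lemma language_mech_shift (a : T) (w : seq (option T)) :
  language mech_shift w <-> mechanical (map isSome w).
Proof.
split=> [[x Yx wx]|[theta ew]].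
  by apply: contrapT => /Yx; apply.
pose f j := if mech theta j then Some a else None.
(* The default value depends on [j], so past the end of [w] the sequence [x] agrees with [f]. *)
pose x j := nth (f j) w j.
have xE j : isSome (x j) = mech theta j.
  rewrite /x; have [wj|jw] := leqP (size w) j.
    by rewrite nth_default // /f; case: ifP.
  rewrite -(nth_map _ false) // ew nth_mkseq // size_map //.
exists x.
  move=> v nv [i ev]; apply: nv; rewrite ev /mkseq -map_comp.
  exact: (@mechanical_sub (isSome \o x) theta).
exists 0%N; apply: (@eq_from_nth _ None); rewrite ?size_mkseq // => j jw.
by rewrite nth_mkseq // add0n /x; apply: set_nth_default.
Qed.

Lemma card_nblocks_mech_shift (a : T) n :
  #|nblocks mech_shift n| = (\sum_(p in mech_tuples n) #|T| ^ count id p)%N.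
Proof.
have -> : nblocks mech_shift n
    = [set w : n.-tuple (option T) | map_tuple isSome w \in mech_tuples n]%SET.
  apply/setP => w; rewrite !inE; apply: asbool_equiv_eq.
  exact: language_mech_shift.
rewrite -sum1_card (partition_big (@map_tuple n _ _ isSome) [in mech_tuples n]).
  apply: eq_bigr => p mp; rewrite -card_isSome_fiber -sum1_card.
  apply: eq_bigl => w; rewrite [RHS]finset.in_set [X in X && _]finset.in_set.
  by case: eqP => [->|_]; rewrite ?andbF // andbT; exact: mp.
by move=> w; rewrite inE.
Qed.

End Mechanical.

Arguments mech_shift {R} alpha T _.

(** * Logarithmic bounds and the entropy limit *)

Lemma log2_expn (R : realType) m : log2 (2 ^ m)%N%:R = m%:R :> R.
Proof.
by rewrite /log2 natrX lnXn // -[X in X / _]mulr_natl mulfK // gt_eqF // ln_gt0 // ltr1n.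
Qed.

Lemma log2M (R : realType) (x y : R) :
  0 < x -> 0 < y -> log2 (x * y) = log2 x + log2 y.
Proof. by move=> x0 y0; rewrite /log2 lnM // mulrDl. Qed.

Lemma ler_log2 (R : realType) (x y : R) : 0 < x -> x <= y -> log2 x <= log2 y.
Proof.
move=> x0 xy; rewrite /log2 ler_pM2r ?invr_gt0 ?ln_gt0 ?ltr1n //.
by rewrite ler_ln // posrE // (lt_le_trans x0).
Qed.

(** Since n + 1 <= (1 + sqrt n)^2, the argument is at most (1 + sqrt n)^4; then ln (1 + x) <= x
    gives the factor 4. Any bound that is o(n) suffices for the entropy. *)
Lemma log2_sqr_le (R : realType) n :
  log2 (n.+1 ^ 2)%N%:R <= 4 / ln 2 * Num.sqrt n%:R :> R.
Proof.
have s0 : 0 <= Num.sqrt n%:R :> R by exact: sqrtr_ge0.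
rewrite /log2 mulrAC ler_pM2r ?invr_gt0 ?ln_gt0 ?ltr1n //.
have s1 : 0 < 1 + Num.sqrt n%:R :> R by lra.
apply: (@le_trans _ _ (ln ((1 + Num.sqrt n%:R) ^+ 4))).
  rewrite ler_ln ?posrE ?ltr0n ?expn_gt0 ?exprn_gt0 //.
  rewrite natrX (exprM _ 2 2) ler_pXn2r ?nnegrE ?exprn_ge0 ?addr_ge0 //.
  rewrite sqrrD sqr_sqrtr // -natr1; lra.
by rewrite lnXn // -[leLHS]mulr_natl ler_pM2l // le_ln1Dx //; lra.
Qed.

Lemma nblocks_mech_shift_itv (R : realType) (alpha : R) k n :
  0 <= alpha <= 1 ->
  (2 ^ (k * Num.truncn (n%:R * alpha))
     <= #|nblocks (mech_shift alpha 'I_(2 ^ k)) n|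
     <= n.+1 ^ 2 * 2 ^ (k * (Num.truncn (n%:R * alpha)).+1))%N.
Proof.
move=> /andP[a0 a1]; set c := Num.truncn _; have k0 : (0 < 2 ^ k)%N by rewrite expn_gt0.
rewrite (card_nblocks_mech_shift _ (Ordinal k0)) card_ord.
under eq_bigr do rewrite -expnM.
apply/andP; split.
  (* For the lower bound the fillings of a single pattern, of intercept 0, suffice. *)
  pose p : n.-tuple bool := mktuple (mech alpha 0).
  have ep : p = mkseq (mech alpha 0) n :> seq bool.
    by rewrite /mkseq -val_enum_ord -map_comp.
  rewrite (bigD1 p) /=; last by apply/mech_tuplesP; exists 0.
  rewrite (leq_trans _ (leq_addr _ _)) // leq_pexp2l // leq_mul2l ep.
  by have /andP[-> _] := count_mech_itv a0 a1 0 n; rewrite orbT.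
apply: (@leq_trans (\sum_(p in mech_tuples alpha n) 2 ^ (k * c.+1))%N).
  apply: leq_sum => p /mech_tuplesP[th ->]; rewrite leq_pexp2l // leq_mul2l.
  by have /andP[_ ->] := count_mech_itv a0 a1 th n; rewrite orbT.
by rewrite sum_nat_const leq_mul2r card_mech_tuples // orbT.
Qed.

Lemma entropy_mech_shift (R : realType) (alpha : R) k : 0 <= alpha <= 1 ->
  entropy_seq R (mech_shift alpha 'I_(2 ^ k)) @ \oo --> k%:R * alpha.
Proof.
(* Passing to index m + 1 discards the junk term and makes the divisor positive. *)
move=> a01; rewrite -cvg_shiftS.
pose r (m : nat) : R := Num.sqrt (harmonic m).
have r_cvg : r @ \oo --> (0 : R).
  have := continuous_cvg _ (@sqrt_continuous R 0) (@cvg_harmonic R).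
  by rewrite sqrtr0; apply.
have r2_cvg : (fun m => r m ^+ 2) @ \oo --> (0 : R).
  by rewrite -(mulr0 (0 : R)); exact: (cvgM r_cvg r_cvg).
have r2E m : r m ^+ 2 = m.+1%:R^-1 by rewrite sqr_sqrtr // harmonic_ge0.
have rE m : m.+1%:R^-1 * Num.sqrt m.+1%:R = r m.
  have s0 : Num.sqrt m.+1%:R != 0 :> R by rewrite gt_eqF // sqrtr_gt0.
  rewrite /r /harmonic /= sqrtrV // -{1}(sqr_sqrtr (ler0n R m.+1)) expr2 invfM.
  by rewrite mulfVK.
(* Here r m = 1 / sqrt (m + 1). Rounding (m + 1) alpha to an integer costs at most k / (m + 1) = k
   (r m)^2, and the polynomial number of patterns costs at most (4 / ln 2) r m. *)
apply: (@squeeze_cvgr _ _ _ _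
  (fun m => k%:R * alpha - k%:R * r m ^+ 2)
  (fun m => k%:R * alpha + k%:R * r m ^+ 2 + 4 / ln 2 * r m)).
- near=> m => /=.
  have /andP[] := @nblocks_mech_shift_itv R alpha k m.+1 a01.
  have /truncn_itv/andP[c1 c2] : 0 <= m.+1%:R * alpha.
    by rewrite mulr_ge0 //; case/andP: a01.
  move: c1 c2; set c := Num.truncn _; set N := #|_| => c1 c2 lN uN.
  have N0 : (0 < N)%N by rewrite (leq_trans _ lN) // expn_gt0.
  have {}lN : (k * c)%N%:R <= log2 N%:R :> R.
    by rewrite -log2_expn ler_log2 ?ltr0n ?expn_gt0 // ler_nat.
  have {}uN : log2 N%:R <= 4 / ln 2 * Num.sqrt m.+1%:R + (k * c.+1)%N%:R :> R.
    apply: (le_trans (ler_log2 (y := (m.+2 ^ 2 * 2 ^ (k * c.+1))%N%:R) _ _)).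
    + by rewrite ltr0n.
    + by rewrite ler_nat.
    rewrite natrM log2M ?ltr0n ?expn_gt0 // log2_expn lerD2r.
    exact: log2_sqr_le.
  have m0 : 0 < m.+1%:R :> R by rewrite ltr0n.
  rewrite /entropy_seq -/N !r2E -rE.
  have mV : m.+1%:R^-1 * m.+1%:R = 1 :> R by rewrite mulVf // gt_eqF.
  set i := m.+1%:R^-1 in mV *.
  have i0 : 0 < i by rewrite invr_gt0.
  have k0 : 0 <= k%:R :> R by [].
  have cl : k%:R * alpha - k%:R * i <= i * (k * c)%N%:R.
    have -> : k%:R * alpha - k%:R * i = i * (k%:R * (m.+1%:R * alpha - 1)).
      by rewrite mulrCA mulrBr mulr1 mulrA mV mul1r mulrBr.
    rewrite ler_pM2l // natrM ler_wpM2l // lerBlDr natr1; exact: ltW.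
  have cu : i * (k * c.+1)%N%:R <= k%:R * alpha + k%:R * i.
    have -> : k%:R * alpha + k%:R * i = i * (k%:R * (m.+1%:R * alpha + 1)).
      by rewrite mulrCA mulrDr mulr1 mulrA mV mul1r mulrDr.
    by rewrite ler_pM2l // natrM ler_wpM2l // -natr1 lerD2r.
  move: lN uN; rewrite -(ler_pM2l i0) => lN.
  rewrite -(ler_pM2l i0) mulrDr [X in _ <= X + _]mulrCA => uN.
  by apply/andP; split; lra.
- rewrite -[X in _ --> X]subr0 -[X in _ - X](mulr0 k%:R).
  by apply: cvgB; [exact: cvg_cst | apply: cvgM => //; exact: cvg_cst].
- rewrite -[X in _ --> X]addr0 -[X in _ --> X + _]addr0.
  rewrite -[X in _ --> _ + X + _](mulr0 k%:R) -[X in _ --> _ + X](mulr0 (4 / ln 2)).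
  apply: cvgD; last by apply: cvgM => //; exact: cvg_cst.
  by apply: cvgD; [exact: cvg_cst | apply: cvgM => //; exact: cvg_cst].
Unshelve. all: by end_near.
Qed.

Lemma mech_shift_neq0 (R : realType) (alpha : R) (T : finType) :
  T -> mech_shift alpha T !=set0.
Proof.
move=> a; have [_ /(_ _)[|x Yx _]] := language_mech_shift alpha a [::].
  (* The empty block is mechanical with any intercept, and a point in which it occurs is a point of
     the shift. *)
  by exists 0.
by exists x.
Qed.

Theorem theorem4 (R : realType) (t : R) (t_gt1 : 1 < t) :
  exists (A : finType) (Y : set (nat -> A)), shift_space Y /\ has_entropy Y t.
Proof.
have t0 : 0 <= t by lra.
(* An integer above t, so that the slope t / k is at most 1. *)
pose k := Num.bound t.
have tk : t < k%:R by exact: archi_boundP.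
have k0 : 0 < k%:R :> R by exact: le_lt_trans tk.
exists (option 'I_(2 ^ k)), (mech_shift (t / k%:R) 'I_(2 ^ k)).
split; first exact: shift_space_mech_shift.
split.
  by apply: mech_shift_neq0; apply: (@Ordinal _ 0); rewrite expn_gt0.
have /(@entropy_mech_shift R _ k) : 0 <= t / k%:R <= 1.
  by rewrite divr_ge0 ?(ltW k0) //= ler_pdivrMr // mul1r ltW.
by rewrite mulrCA divff ?mulr1 // gt_eqF.
Qed.
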